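(* Let $T$ be an ordinary numerical semigroup, $I$ a non-empty set of non-negative integers, and $\emptyset\ne J\subseteq I$. Then $\operatorname{Betti}(S_J^I(T))\subseteq 2\mathcal{A}(S_J^I(T))$.
   Context: $\mathbb{N}$ is the set of non-negative integers. For a non-empty set $I\subseteq\mathbb{N}$, $\mathbb{N}^{(I)}$ is the additive monoid (componentwise addition) of all sequences $(n_i)_{i\in I}$ of non-negative integers with $n_i=0$ for all but finitely many $i$; $\mathbf{0}$ is the zero sequence. An ordinary numerical semigroup is a submonoid of $\mathbb{N}$ of the form $T=\{0\}\cup(m+\mathbb{N})$ with $m$ a positive integer. For $\emptyset\ne J\subseteq I$ and $\mathbf{x}=(x_i)_{i\in I}\in\mathbb{N}^{(I)}$, put $|\mathbf{x}|_J=\sum_{j\in J}x_j$, and define the submonoid $S_J^I(T)=\{\mathbf{x}\in\mathbb{N}^{(I)}:|\mathbf{x}|_J\in T\setminus\{0\}\}\cup\{\mathbf{0}\}$ of $\mathbb{N}^{(I)}$. For a submonoid $S$ of $\mathbb{N}^{(I)}$, $S^*=S\setminus\{\mathbf{0}\}$, $\mathcal{A}(S)=S^*\setminus(S^*+S^* )$ is the set of atoms and $2\mathcal{A}(S)=\mathcal{A}(S)+\mathcal{A}(S)$. Write $\mathbf{a}\le_S\mathbf{b}$ if $\mathbf{b}-\mathbf{a}\in S$. For $\mathbf{s}\in S$, $\mathbf{G}_{\mathbf{s}}$ is the graph whose vertices are the atoms $\mathbf{a}$ of $S$ with $\mathbf{a}\le_S\mathbf{s}$, two distinct vertices $\mathbf{a},\mathbf{b}$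 being joined by an edge if $\mathbf{a}+\mathbf{b}\le_S\mathbf{s}$. The element $\mathbf{s}$ is a Betti element of $S$ if $\mathbf{G}_{\mathbf{s}}$ is not connected, i.e. it has at least two connected components (the empty graph $\mathbf{G}_{\mathbf{0}}$ is not counted as disconnected); $\operatorname{Betti}(S)$ is the set of Betti elements of $S$. *)

(* Defs.v *)
From HB Require Import structures.
From mathcomp Require Import all_boot all_order all_algebra.
From mathcomp Require Import finmap.
From mathcomp Require Import all_classical.

Set Implicit Arguments.
Unset Strict Implicit.
Unset Printing Implicit Defensive.

Import GRing.Theory.

Local Open Scope classical_set_scope.
Local Open Scope ring_scope.

(* N^(I): sequences are indexed by the subtype {i : nat | i \in I}. *)
Definition fsnat (I : set nat) : Type := {fsfun I -> nat with 0%N}.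

HB.instance Definition _ (I : set nat) := 
  Choice.copy (fsnat I) {fsfun I -> nat with 0%N}.

Section FsnatNmodule.
Variable I : set nat.

Definition fsnat_fun (x : fsnat I) : I -> nat :=
  fun_of_fsfun (x : {fsfun I -> nat with 0%N}).
Coercion fsnat_fun : fsnat >-> Funclass.

Definition fsnat_supp (x : fsnat I) : {fset I} :=
  finsupp (x : {fsfun I -> nat with 0%N}).

Definition fsnat_zero : fsnat I := [fsfun].

Definition fsnat_add (x y : fsnat I) : fsnat I :=
  [fsfun i in (fsnat_supp x `|` fsnat_supp y)%fset => (x i + y i)%N].

Lemma fsnat_zeroE i : fsnat_zero i = 0%N.
Proof. by rewrite /fsnat_zero /fsnat_fun fsfun0E. Qed.

Lemma fsnat_addE x y i : fsnat_add x y i = (x i + y i)%N.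
Proof.
rewrite /fsnat_add {1}/fsnat_fun fsfun_fun; case: ifP => //.
rewrite in_fsetU => /negbT; rewrite negb_or => /andP[xi yi].
by rewrite /fsnat_fun !fsfun_dflt.
Qed.

Lemma fsnatP (x y : fsnat I) : x =1 y <-> x = y.
Proof. exact: fsfunP. Qed.

Lemma fsnat_addA : associative fsnat_add.
Proof. by move=> x y z; apply/fsnatP => i; rewrite !fsnat_addE addnA. Qed.

Lemma fsnat_addC : commutative fsnat_add.
Proof. by move=> x y; apply/fsnatP => i; rewrite !fsnat_addE addnC. Qed.

Lemma fsnat_add0 : left_id fsnat_zero fsnat_add.
Proof. by move=> x; apply/fsnatP => i; rewrite fsnat_addE fsnat_zeroE. Qed.

HB.instance Definition _ :=
  GRing.isNmodule.Build (fsnat I) fsnat_addA fsnat_addC fsnat_add0.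

End FsnatNmodule.

Section Betti.
Variable M : nmodType.
Implicit Types (S A B : set M) (a b s : M).

Definition sumset A B : set M := [set a + b | a in A & b in B].

Definition nonzero S : set M := S `\ 0.

Definition atoms S : set M := nonzero S `\` sumset (nonzero S) (nonzero S).

(* In N^(I), which is cancellative, this says that b - a exists and is in S. *)
Definition le_in S a b : Prop := exists2 c, S c & b = a + c.

Definition submonoid S : Prop :=
  S 0 /\ forall a b, S a -> S b -> S (a + b).

Definition Gvertex S s : set M := [set a | atoms S a /\ le_in S a s].

Definition Gedge S s a b : Prop :=
  [/\ Gvertex S s a, Gvertex S s b, a <> b & le_in S (a + b) s].

Definition Gconnected S s a b : Prop :=
  exists p : seq M, path (fun u v => `[< Gedge S s u v >]) a p /\ b = last a p.

Definition Gcomponent S s a : set M :=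
  [set b | Gvertex S s b /\ Gconnected S s a b].

Definition Gcomponents S s : set (set M) := Gcomponent S s @` Gvertex S s.

(* A disconnected graph has two distinct components, so G_0, being empty, does
   not count as disconnected. *)
Definition Betti S : set M :=
  [set s | S s /\ exists C D : set M,
     [/\ Gcomponents S s C, Gcomponents S s D & C <> D]].

End Betti.

Definition ordinary (T : set nat) : Prop :=
  exists2 m, (0 < m)%N & T = [set 0%N] `|` [set (m + n)%N | n in [set: nat]].

Definition wt (I J : set nat) (x : fsnat I) : nat :=
  (\sum_(i <- fsnat_supp x | val i \in J) x i)%N.

Definition SJ (I J T : set nat) : set (fsnat I) :=
  [set x : fsnat I | (T `\ 0%N) (wt J x)] `|` [set 0].

Lemma ordinary_submonoid (T : set nat) : ordinary T -> submonoid T.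
Proof.
move=> [m m0 ->]; split; first by left.
move=> _ _ [->|[n _ <-]] [->|[k _ <-]]; first by left.
- by right; exists k.
- by right; exists n => //; rewrite addr0.
- by right; exists (n + (m + k))%N => //; rewrite addnA.
Qed.

Lemma wtE (I J : set nat) (A : {fset I}) (x : fsnat I) :
  (fsnat_supp x `<=` A)%fset -> wt J x = (\sum_(i <- A | val i \in J) x i)%N.
Proof.
move=> sA; rewrite /wt [RHS]big_mkcond [LHS]big_mkcond /=.
apply: big_fset_incl => // i _ /fsfun_dflt xi.
by case: ifP => // _; exact: xi.
Qed.

Lemma wtD (I J : set nat) (x y : fsnat I) : wt J (x + y) = (wt J x + wt J y)%N.
Proof.
pose A := (fsnat_supp x `|` fsnat_supp y `|` fsnat_supp (x + y)%R)%fset.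
have [sx sy sxy] : [/\ (fsnat_supp x `<=` A)%fset, (fsnat_supp y `<=` A)%fset
    & (fsnat_supp (x + y)%R `<=` A)%fset].
  by split; apply/fsubsetP => i ii; rewrite /A !in_fsetU ii ?orbT.
rewrite (wtE _ sx) (wtE _ sy) (wtE _ sxy).
by rewrite -big_split; apply: eq_bigr => i _; exact: fsnat_addE.
Qed.

Lemma SJ_submonoid (I J T : set nat) : ordinary T -> submonoid (@SJ I J T).
Proof.
move=> /ordinary_submonoid[_ TD]; split; first by right.
move=> x y [[Tx x0]|->]; last by rewrite add0r.
case=> [[Ty y0]|->]; last by rewrite addr0; left.
left; rewrite /= wtD; split; first exact: TD.
by move=> /= /eqP; rewrite addn_eq0 => /andP[/eqP /x0].
Qed.

Arguments SJ : clear implicits.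

(* Main.v *)
(* Write T = {0} u (m + N). Every x splits as y + z with |y|_J any prescribed
   value at most |x|_J, so the atoms are the x with m <= |x|_J < 2m, and every
   s with 2m <= |s|_J <= 4m - 2 is a sum of two atoms. If |s|_J < 2m, then s is
   the only possible vertex of G_s. If |s|_J >= 4m - 1, every vertex has a
   neighbour (or is itself) of weight m, and two vertices a, b of weight m are
   both linked to any c of weight m below s - max(a, b), which exists since
   |max(a, b)|_J <= 2m. *)
Require Import Defs.
From mathcomp Require Import all_boot all_order all_algebra.
From mathcomp Require Import finmap.
From mathcomp Require Import all_classical.
From mathcomp Require Import zify.

Import GRing.Theory.

Local Open Scope classical_set_scope.

Section Graph.
Variable M : nmodType.
Implicit Types (S : set M) (a b c s : M).

Lemma Gconnected_refl S s a : Gconnected S s a a.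
Proof. by exists [::]. Qed.

Lemma Gconnected_trans S s b a c :
  Gconnected S s a b -> Gconnected S s b c -> Gconnected S s a c.
Proof.
move=> [p [pp ->]] [q [qq ->]]; exists (p ++ q).
by rewrite cat_path pp qq last_cat.
Qed.

(** [Gedge] asks for distinct ends, so the case [a = b] is served by the empty path; later uses need
    not separate it. *)
Lemma Gconnected_summand S s a b : Gvertex S s a -> Gvertex S s b ->
  le_in S (a + b)%R s -> Gconnected S s a b.
Proof.
move=> Ga Gb ab; have [<-|/eqP neq] := eqVneq a b.
  exact: Gconnected_refl.
by exists [:: b]; split=> //=; rewrite andbT; apply/asboolP.
Qed.

(** Under the assumption, the component of any vertex is the whole vertex set, so two components
    cannot differ. *)
Lemma connected_not_Betti S s :
  (forall a b, Gvertex S s a -> Gvertex S s b -> Gconnected S s a b) ->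
  ~ Betti S s.
Proof.
move=> conn [_ [C [D [[a Ga <-] [b Gb <-]]]]]; apply.
by apply/seteqP; split=> c [Gc _]; split=> //; apply: conn.
Qed.

End Graph.

Section Fsnat.
Variable I : set nat.
Implicit Types (J : set nat) (x y a b : fsnat I) (i : I).

Lemma fsnatDE x y i : fsnat_fun (x + y)%R i = (x i + y i)%N.
Proof. exact: fsnat_addE. Qed.

Lemma fsnat_of (A : {fset I}) (f : I -> nat) :
  (forall i, i \notin A -> f i = 0%N) -> exists x : fsnat I, x =1 f.
Proof.
move=> f0; exists ([fsfun i in A => f i] : {fsfun I -> nat with 0%N}) => i.
by rewrite [LHS]fsfun_fun; case: ifP => // /negbT /f0.
Qed.

Lemma fsnat_supp0 x i : i \notin fsnat_supp x -> x i = 0%N.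
Proof. exact: fsfun_dflt. Qed.

Lemma fsnat_diff x y : (forall i, y i <= x i)%N -> exists z, x = (y + z)%R.
Proof.
move=> yx; have [i /fsnat_supp0 xi|z zE] :=
  @fsnat_of (fsnat_supp x) (fun i => x i - y i)%N; first by rewrite xi.
by exists z; apply/fsnatP => i; rewrite fsnatDE zE subnKC.
Qed.

Lemma fsnat_max a b : exists x : fsnat I, forall i, x i = maxn (a i) (b i).
Proof.
apply: (@fsnat_of (fsnat_supp a `|` fsnat_supp b)%fset) => i.
by rewrite in_fsetU negb_or => /andP[/fsnat_supp0 -> /fsnat_supp0 ->].
Qed.

Lemma fsnat_delta i0 : exists x : fsnat I, forall i, x i = (i == i0).
Proof.
apply: (@fsnat_of [fset i0]%fset) => i.
by rewrite in_fset1 => /negbTE ->.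
Qed.

Lemma wt0 J : wt J (0%R : fsnat I) = 0%N.
Proof. by have := @wtD I J 0%R 0%R; rewrite addr0; lia. Qed.

(** Induction on [k]: one unit moves from [z] to [y] at an index of [J] where [z] is positive. *)
Lemma wt_split J x k : (k <= wt J x)%N ->
  exists y z, x = (y + z)%R /\ wt J y = k.
Proof.
elim: k => [|k IH] kx; first by exists 0%R, x; rewrite add0r wt0.
have [y [z [xE yk]]] := IH (ltnW kx).
have z0 : (0 < wt J z)%N by move: kx; rewrite xE wtD; lia.
have [i0 [iJ zi]] : exists i0 : I, val i0 \in J /\ (0 < z i0)%N.
  (* Otherwise every term of the sum defining [wt J z] vanishes. *)
  apply: contrapT => nex; move: z0; rewrite /wt big1 // => i iJ.
  by apply/eqP; rewrite -leqn0 leqNgt; apply/negP => zi; apply: nex; exists i.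
have [e eE] := fsnat_delta i0.
have [|z' zE] := @fsnat_diff z e.
  by move=> i; rewrite eE; case: (i =P i0) => [->|].
exists (y + e)%R, z'; rewrite xE zE addrA; split=> //.
have sub : (fsnat_supp e `<=` [fset i0])%fset.
  apply/fsubsetP => i; apply: contraLR; rewrite in_fset1 => /negbTE ni.
  by rewrite mem_finsupp negbK; have := eE i; rewrite ni => /eqP.
rewrite wtD (@wtE I J _ e sub) big_mkcond big_seq_fset1 iJ eE eqxx yk.
by rewrite addn1.
Qed.

End Fsnat.

Section OrdinaryAtoms.
Variables (I J T : set nat) (m : nat).
Hypothesis m_gt0 : (0 < m)%N.
Hypothesis TE : T = [set 0%N] `|` [set (m + n)%N | n in [set: nat]].
Implicit Types x a b s : fsnat I.

Let S := SJ I J T.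

Lemma SJ_wtP x : S x <-> (m <= wt J x)%N \/ x = 0%R.
Proof.
rewrite /S /SJ TE; split=> [[[[->|[n _ <-]] w0]|->]|[mx|->]].
- by case: w0.
- by left; rewrite leq_addr.
- by right.
- left; split=> [|/= x0]; last by lia.
  by right; exists (wt J x - m)%N => //; rewrite subnKC.
- by right.
Qed.

Lemma nonzero_SJ_wtP x : nonzero S x <-> (m <= wt J x)%N.
Proof.
split=> [[/SJ_wtP[]//]|mx]; split; first by apply/SJ_wtP; left.
by move=> /= x0; move: mx; rewrite x0 wt0; lia.
Qed.

(** From weight [2m] on, a part of weight exactly [m] splits off and leaves at least [m];
    conversely, two nonzero elements add up to weight at least [2m]. *)
Lemma atoms_wtP x : atoms S x <-> (m <= wt J x < m.*2)%N.
Proof.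
split=> [[/nonzero_SJ_wtP mx nsum]|/andP[mx xm]].
  rewrite mx /= ltnNge; apply/negP => xm; apply: nsum.
  have [y [z [xE yk]]] := @wt_split I J x m mx.
  move: xm; rewrite xE wtD yk => xm.
  exists y; first by apply/nonzero_SJ_wtP; rewrite yk.
  by exists z => //; apply/nonzero_SJ_wtP; lia.
split; first exact/nonzero_SJ_wtP.
move=> [y /nonzero_SJ_wtP my [z /nonzero_SJ_wtP mz xE]].
by move: xm; rewrite -xE wtD; lia.
Qed.

Lemma le_in_wt x s c : s = (x + c)%R -> (m <= wt J c)%N -> le_in S x s.
Proof. by move=> sE mc; exists c => //; apply/SJ_wtP; left. Qed.

Lemma small_vertex s a : (wt J s < m.*2)%N -> Gvertex S s a -> a = s.
Proof.
move=> sm [/atoms_wtP/andP[ma _] [c /SJ_wtP[mc|->] sE]].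
  by move: sm; rewrite sE wtD; lia.
by rewrite sE addr0.
Qed.

Lemma middle_sum_atoms s : (m.*2 <= wt J s)%N -> (wt J s < m.*2 + m.*2 - 1)%N ->
  sumset (atoms S) (atoms S) s.
Proof.
(* The weight of [y] is the largest atom weight that leaves at least [m] for [z]; as
   [|s|_J <= 4m - 2], at most [2m - 1] is left. *)
move=> ms sm; have [|y [z [sE yk]]] :=
  @wt_split I J s (minn (m.*2 - 1) (wt J s - m)); first by lia.
have := wtD J y z; rewrite -sE => sw.
exists y; first by apply/atoms_wtP; lia.
by exists z => //; apply/atoms_wtP; lia.
Qed.

Section LargeWeight.
Variable s : fsnat I.
Hypothesis s_large : (m.*2 + m.*2 - 1 <= wt J s)%N.

Lemma large_vertex a c : s = (a + c)%R -> (m <= wt J a < m.*2)%N ->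
  Gvertex S s a.
Proof.
move=> sE am; split; first exact/atoms_wtP.
by apply: (@le_in_wt _ _ c) => //; move: s_large; rewrite sE wtD; lia.
Qed.

(** An atom weighs at most [2m - 1], so [s - a] weighs at least [2m]: it contains some [b] of weight
    [m] and a rest in [S]. Both directions are recorded because [Gconnected] is stated by paths from
    its first argument. *)
Lemma vertex_wt_m a : Gvertex S s a -> exists b,
  [/\ Gvertex S s b, wt J b = m, Gconnected S s a b & Gconnected S s b a].
Proof.
move=> Ga; have [/atoms_wtP am [c _ sE]] := Ga.
have cw : (m.*2 <= wt J c)%N by move: s_large; rewrite sE wtD; lia.
have [|b [d [cE bm]]] := @wt_split I J c m; first by lia.
have Gb : Gvertex S s b.
  by apply: (@large_vertex b (a + d)%R); [rewrite sE cE addrCA | lia].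
have dm : (m <= wt J d)%N by move: cw; rewrite cE wtD; lia.
by exists b; split=> //; apply: Gconnected_summand => //;
  apply: (@le_in_wt _ _ d) => //; rewrite sE cE addrA // [(b + a)%R]addrC.
Qed.

Lemma connected_wt_m a b : Gvertex S s a -> Gvertex S s b ->
  wt J a = m -> wt J b = m -> Gconnected S s a b.
Proof.
move=> Ga Gb am bm.
have [[_ [a' _ sa]] [_ [b' _ sb]]] := (Ga, Gb).
(* The pointwise maximum stays below [s], whereas [a + b] need not; being below [a + b], it weighs
   at most [2m]. *)
have [u uE] := fsnat_max I a b.
have [i|r sr] := @fsnat_diff I s u.
  by rewrite uE geq_max; apply/andP; split; [rewrite sa|rewrite sb];
    rewrite fsnatDE leq_addr.
have [i|p up] := @fsnat_diff I u a; first by rewrite uE leq_maxl.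
have [i|q uq] := @fsnat_diff I u b; first by rewrite uE leq_maxr.
have [i|v abv] := @fsnat_diff I (a + b)%R u.
  by rewrite uE fsnatDE geq_max leq_addr leq_addl.
have ru : (wt J u <= m.*2)%N.
  by have := wtD J a b; rewrite abv wtD; lia.
(* Here [r = s - u] weighs at least [2m - 1], hence at least [m] since [m] is positive. *)
have [|c [d [rE cm]]] := @wt_split I J r m.
  by move: s_large; rewrite sr wtD; lia.
have Gc : Gvertex S s c.
  by apply: (@large_vertex c (u + d)%R); [rewrite sr rE addrCA | lia].
apply: (@Gconnected_trans _ _ _ c); apply: Gconnected_summand => //.
(* The sum [a + c] weighs exactly [2m], so the rest again weighs at least [2m - 1] and lies in
   [S]. *)
- have sE : s = (a + c + (p + d))%R by rewrite sr up rE addrACA.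
  apply: (@le_in_wt _ _ _ sE).
  by move: s_large; rewrite sE wtD [wt J (a + c)%R]wtD; lia.
- have sE : s = (c + b + (q + d))%R.
    by rewrite sr uq rE addrACA [(b + c)%R]addrC.
  apply: (@le_in_wt _ _ _ sE).
  by move: s_large; rewrite sE wtD [wt J (c + b)%R]wtD; lia.
Qed.

Lemma large_connected a b :
  Gvertex S s a -> Gvertex S s b -> Gconnected S s a b.
Proof.
move=> /vertex_wt_m[a' [Ga' am aa' _]] /vertex_wt_m[b' [Gb' bm _ b'b]].
apply: (Gconnected_trans _ _ _ _ _ _ aa').
by apply: Gconnected_trans b'b; apply: connected_wt_m.
Qed.

End LargeWeight.

End OrdinaryAtoms.

Theorem proposition7p7 (T I J : set nat) (hT : ordinary T)
  (hI : I !=set0) (hJ : J !=set0) (hJI : J `<=` I) :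
  Betti (SJ I J T) `<=` sumset (atoms (SJ I J T)) (atoms (SJ I J T)).
Proof.
have [m m_gt0 TE] := hT => s sBetti.
have [ms|sm] := leqP m.*2 (wt J s); last first.
  (* Below weight [2m] the graph has at most the vertex [s]. *)
  exfalso; apply: connected_not_Betti sBetti => a b.
  move=> /(small_vertex _ _ _ _ m_gt0 TE _ _ sm) ->.
  move=> /(small_vertex _ _ _ _ m_gt0 TE _ _ sm) ->.
  exact: Gconnected_refl.
have [sl|] := leqP (m.*2 + m.*2 - 1) (wt J s); last exact: middle_sum_atoms.
exfalso; apply: connected_not_Betti sBetti => a b.
exact: (large_connected _ _ _ _ m_gt0 TE).
Qed.
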